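(* Let $k \in \mathbb{N}$ and let $G$ be a graph with maximum degree $\Delta(G)$ and maximum average degree ${\rm mad}(G)<k$. 1. If $\Delta(G) \ge \frac{k^2}{2}+\frac{3k}{2}-2$, then $G$ is incidence $(\Delta(G)+k-1,\,k-1)$-colorable. 2. For every real $\alpha>0$, if $\Delta(G) \ge \frac{3\alpha+1}{2\alpha}k-2$, then $G$ is incidence $(\Delta(G)+(1+\alpha)k-1,\,(1+\alpha)k-1)$-colorable.
   Context: All graphs are simple, finite, non-empty and connected. An incidence of $G$ is a pair $(v,e)$ with $v$ a vertex and $e$ an edge incident to $v$. Two incidences $(u,e)$ and $(v,f)$ are adjacent if $u=v$, or $e=f$, or $uv=e$ or $uv=f$. An incidence coloring assigns colors to incidences so that adjacent incidences receive distinct colors; $G$ is incidence $k$-colorable ($k$ possibly non-integer) if it has an incidence coloring using only integers between $1$ and $k$. For a vertex $u$, a weak incidence of $u$ is an incidence $(v,vu)$ for a neighbor $v$ of $u$. An incidence $(k,\ell)$-coloring ($k,\ell$ possibly non-integer) is an incidence coloring with colors among integers in $[1,k]$ such that for every vertex $u$, at most $\ell$ distinct colors appear on the weak incidences of $u$. ${\rm mad}(G)=\max\{2|E(H)|/|V(H)| : H\subseteq G\}$. *)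

(* Defs.v *)
From mathcomp Require Import all_boot all_order all_algebra.
From mathcomp Require Import reals.

Set Implicit Arguments.
Unset Strict Implicit.
Unset Printing Implicit Defensive.

Import Order.TTheory GRing.Theory Num.Theory.
Local Open Scope ring_scope.

Record sgraph := SGraph {
  vertex :> finType;
  adj : rel vertex;
  adj_sym : symmetric adj;
  adj_irrefl : irreflexive adj }.

Definition connected_graph (G : sgraph) : Prop :=
  forall x y : G, connect (@adj G) x y.

Definition neighbors (G : sgraph) (v : G) : {set G} := [set u | adj v u].

Definition max_degree (G : sgraph) : nat := (\max_(v : G) #|neighbors v|)%N.

Definition edges (G : sgraph) : {set {set G}} :=
  [set E : {set G} | [exists x, exists y, adj x y && (E == [set x; y])]].

Definition is_subgraph (G : sgraph) (V : {set G}) (E : {set {set G}}) : bool :=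
  [&& V != set0, E \subset edges G & [forall A in E, A \subset V]].

(* All ratios are nonnegative, and G has a subgraph as soon as it has a vertex,
   so the default value 0 does not affect the maximum of a nonempty graph. *)
Definition mad (R : realFieldType) (G : sgraph) : R :=
  \big[Order.max/0]_(H : {set G} * {set {set G}} | is_subgraph H.1 H.2)
    (2 * #|H.2|%:R / #|H.1|%:R).

Definition is_incidence (G : sgraph) (i : G * {set G}) : bool :=
  (i.2 \in edges G) && (i.1 \in i.2).

Definition incidence_adj (G : sgraph) (i j : G * {set G}) : bool :=
  [|| i.1 == j.1, i.2 == j.2, [set i.1; j.1] == i.2 | [set i.1; j.1] == j.2].

(* A coloring is a function on all pairs of a vertex and a vertex set, but only
   its values on incidences matter.  As incidence_adj i i holds, distinct
   incidences have to be required explicitly. *)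
Definition incidence_coloring (G : sgraph) (c : G * {set G} -> nat) : Prop :=
  forall i j : G * {set G}, is_incidence i -> is_incidence j ->
    i != j -> incidence_adj i j -> c i != c j.

Definition weak_incidences (G : sgraph) (u : G) : {set G * {set G}} :=
  [set (v, [set v; u]) | v in neighbors u].

Definition nb_weak_colors (G : sgraph) (c : G * {set G} -> nat) (u : G) : nat :=
  size (undup [seq c i | i in weak_incidences u]).

Definition incidence_colorable (R : realFieldType) (G : sgraph) (k l : R) :
    Prop :=
  exists c : G * {set G} -> nat,
    [/\ incidence_coloring c,
        forall i, is_incidence i -> (1 <= c i)%N /\ (c i)%:R <= k
      & forall u : G, (nb_weak_colors c u)%:R <= l].

(* Main.v *)
(* Let M be the maximum degree and L the integer part of the bound on weak
   colors; use M + L colors and color the induced subgraphs G[X] by induction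
   on X.  A vertex u of degree d <= L can be deleted as soon as at most
   L + 1 - d of its neighbors are big, i.e. have degree at least M + 2 - d:
   color the incidences from the big neighbors to u, then the incidences of u
   by a system of distinct representatives of the palettes of its neighbors
   avoiding those colors, and last the incidences from the small neighbors,
   whose degree leaves enough freedom.  If no vertex can be deleted, every
   vertex of degree d < k has at least L + 2 - d big neighbors; letting each
   big vertex of degree D give 1 - k/D to each of these neighbors brings all
   charges to at least k, against the bound on the average degree. *)
Require Import Defs.
From mathcomp Require Import all_boot all_order all_algebra.
From mathcomp Require Import reals.
From mathcomp Require Import lra zify.
Import Order.TTheory GRing.Theory Num.Theory.
Local Open Scope ring_scope.

Set Implicit Arguments.
Unset Strict Implicit.
Unset Printing Implicit Defensive.

(** * Finite sets and distinct representatives *)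

Lemma set2_inj (T : finType) (v w w' : T) :
  [set v; w] = [set v; w'] -> w = w'.
Proof.
move=> e.
have /set2P[w_v|//] : w \in [set v; w'] by rewrite -e set22.
have /set2P[->//|->//] : w' \in [set v; w] by rewrite e set22.
Qed.

Lemma avoid_set (C : finType) (A : {set C}) :
  (#|A| < #|C|)%N -> exists c, c \notin A.
Proof.
move=> ltAC; have /set0Pn[c] : ~: A != set0 by rewrite -card_gt0 cardsCs setCK subn_gt0.
by rewrite inE; exists c.
Qed.

Lemma dep_choice_in (T C : finType) (c0 : C) (D : {set T}) (P : T -> pred C) :
  (forall w, w \in D -> exists c, P w c) ->
  exists g : T -> C, forall w, w \in D -> P w (g w).
Proof.
move=> ex; exists (fun w => odflt c0 [pick c | P w c]) => w /ex[c Pc].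
by case: pickP => [//|/(_ c)]; rewrite Pc.
Qed.

Lemma intermediate_set (C : finType) (A B : {set C}) (n : nat) :
  A \subset B -> (#|A| <= n <= #|B|)%N ->
  exists W : {set C}, [/\ A \subset W, W \subset B & #|W| = n].
Proof.
move=> sAB; elim: n => [|n IH] /andP[leA leB].
  by exists A; split => //; apply/eqP; rewrite -leqn0.
case: (leqP #|A| n) => [leAn|ltnA].
  have [|W [sAW sWB cW]] := IH; first by rewrite leAn ltnW.
  have /properP[_ [c cB cW']] : W \proper B by rewrite properEcard sWB cW.
  exists (c |: W); split; rewrite ?cardsU1 ?cW' ?cW //.
    by rewrite (subset_trans sAW) // subsetUr.
  by rewrite subUset sub1set cB.
by exists A; split => //; apply/eqP; rewrite eqn_leq leA.
Qed.

(** Greedy choice: when some [w] moves from [D1] to [D0], at most [#|D0| < #|A w|] values are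
    already taken. Keeping [D0] apart lets the lists be processed in two rounds with different size
    bounds. *)
Lemma extend_distinct_representatives (T C : finType) (A : T -> {set C})
    (D0 D1 : {set T}) (g : T -> C) :
  {in D0 &, injective g} -> (forall w, w \in D0 -> g w \in A w) ->
  (forall w, w \in D1 -> (#|D0| + #|D1| <= #|A w|)%N) -> [disjoint D0 & D1] ->
  exists h : T -> C, {in D0 :|: D1 &, injective h} /\
    (forall w, w \in D0 :|: D1 -> h w \in A w).
Proof.
have [n] := ubnP #|D1|; elim: n D1 D0 g => // n IH D1 D0 g ltn gi gA cA dis.
have [D1_0|[w wD1]] := set_0Vmem D1.
  by rewrite D1_0 setU0; exists g.
have wD0 : w \notin D0 by apply: contraL wD1 => wD0; rewrite (disjointFr dis).
have cD1 : #|D1| = #|D1 :\ w|.+1 by rewrite (cardsD1 w) wD1.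
have [c cAw cg] : exists2 c, c \in A w & c \notin g @: D0.
  suff /set0Pn[c] : A w :\: g @: D0 != set0 by rewrite inE => /andP[]; exists c.
  have := cA w wD1; have := leq_imset_card g D0.
  have := cardsID (g @: D0) (A w); have := subset_leq_card (subsetIr (A w) (g @: D0)).
  rewrite -card_gt0; lia.
pose g' v := if v == w then c else g v.
have g'E v : v \in D0 -> g' v = g v.
  by rewrite /g'; case: eqP => // ->; rewrite (negPf wD0).
have g'w : g' w = c by rewrite /g' eqxx.
have -> : D0 :|: D1 = (w |: D0) :|: (D1 :\ w).
  by apply/setP => v; rewrite !inE; case: eqP => // ->; rewrite wD1 orbT.
apply: (IH _ _ g'); first by rewrite cD1 in ltn.
- move=> x y /setU1P[->|xD] /setU1P[->|yD] //.
  + by rewrite g'w (g'E y) // => cE; case/imsetP: cg; exists y.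
  + by rewrite g'w (g'E x) // => cE; case/imsetP: cg; exists x.
  + by rewrite !g'E //; apply: gi.
- move=> x /setU1P[->|xD]; first by rewrite g'w.
  by rewrite g'E // gA.
- move=> x /setD1P[_ /cA]; rewrite cardsU1 wD0 cD1; lia.
- rewrite disjoints_subset; apply/subsetP => x /setU1P[->|xD]; rewrite !inE ?eqxx //.
  by rewrite (disjointFr dis) // andbF.
Qed.

(** * Palette colorings and their extension to a deleted vertex *)

Definition induced_neighbors (G : sgraph) (X : {set G}) (v : G) : {set G} :=
  neighbors v :&: X.

(* [f v w] is the color of the incidence [(v, vw)], and [W v] is a palette
   reserved for the weak incidences of [v]; its size is exactly [L], which
   makes the palettes of old vertices immutable in the induction. *)
Definition palette_coloring (G : sgraph) (C : finType) (L : nat) (X : {set G})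
    (f : G -> G -> C) (W : G -> {set C}) : Prop :=
  forall v, v \in X ->
    [/\ #|W v| = L, {in induced_neighbors X v &, injective (f v)},
        forall x, x \in induced_neighbors X v -> f v x \notin W v
      & forall x, x \in induced_neighbors X v -> f x v \in W v].

(** The threshold is where a last-moment choice for [(w, wu)] may fail: the palette and other
    incidences of [w] forbid at most [L + deg w - 1] colors, the other incidences of [u] at most
    [deg u - 1], and there are [M + L] colors. *)
Definition big_neighbors (G : sgraph) (M : nat) (X : {set G}) (u : G) :
    {set G} :=
  [set v in induced_neighbors X u |
     (M.+1 < #|induced_neighbors X v| + #|induced_neighbors X u|)%N].

Lemma induced_neighborsD1 (G : sgraph) (X : {set G}) (u v : G) :
  induced_neighbors (X :\ u) v = induced_neighbors X v :\ u.
Proof. by apply/setP => x; rewrite !inE andbCA. Qed.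

Lemma mem_induced_neighbors (G : sgraph) (X : {set G}) (u v : G) :
  (v \in induced_neighbors X u) = adj u v && (v \in X).
Proof. by rewrite !inE. Qed.

Lemma induced_neighbors_sym (G : sgraph) (X : {set G}) (u v : G) :
  u \in X -> v \in induced_neighbors X u -> u \in induced_neighbors X v.
Proof. by rewrite !mem_induced_neighbors adj_sym => -> /andP[-> _]. Qed.

Lemma leq_induced_neighbors (G : sgraph) (X : {set G}) (v : G) :
  (#|induced_neighbors X v| <= max_degree G)%N.
Proof.
apply: leq_trans (leq_bigmax v).
exact: subset_leq_card (subsetIl _ _).
Qed.

Lemma extend_palette_coloring (G : sgraph) (C : finType) (c0 : C) (L M : nat)
    (X : {set G}) (u : G) (f : G -> G -> C) (W : G -> {set C}) :
  #|C| = (M + L)%N ->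
  (forall v, v \in X -> (#|induced_neighbors X v| <= M)%N) ->
  u \in X -> (#|induced_neighbors X u| <= L)%N ->
  (#|big_neighbors M X u| + #|induced_neighbors X u| <= L.+1)%N ->
  palette_coloring L (X :\ u) f W ->
  exists (f' : G -> G -> C) (W' : G -> {set C}), palette_coloring L X f' W'.
Proof.
move=> cardC degM uX degL bigL col.
set D := induced_neighbors X u in degL bigL *.
set B := big_neighbors M X u in bigL *.
have sBD : B \subset D by apply/subsetP => v; rewrite inE => /andP[].
have Dadj w : w \in D -> w \in X :\ u.
  rewrite mem_induced_neighbors !inE => /andP[uw ->]; rewrite andbT.
  by apply: contraTneq uw => ->; rewrite adj_irrefl.
(* Colors that the old coloring forbids for the incidence [(w, wu)]. *)
pose F w := W w :|: f w @: (induced_neighbors X w :\ u).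
have cardF w : w \in D -> (#|F w| < L + #|induced_neighbors X w|)%N.
  move=> wD; have [cW _ _ _] := col w (Dadj w wD).
  have uNw := induced_neighbors_sym uX wD.
  have := leq_imset_card (f w) (induced_neighbors X w :\ u).
  have := cardsD1 u (induced_neighbors X w); rewrite uNw.
  have := (leq_card_setU (W w) (f w @: (induced_neighbors X w :\ u))).1.
  rewrite -/(F w) cW; lia.
have DX w : w \in D -> w \in X by move/Dadj/setD1P => [].
(* The colors [a0 w] are final only for big [w]; the other neighbors are recolored below. *)
have [a0 a0P] : exists a0 : G -> C, forall w, w \in D -> a0 w \notin F w.
  apply: (dep_choice_in c0 (P := fun w c => c \notin F w)) => w wD.
  apply: avoid_set; apply: leq_trans (cardF w wD) _.
  by rewrite cardC addnC leq_add2r degM ?DX.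
pose A w := W w :\: a0 @: B.
have cardA w (n : nat) : w \in D -> (#|W w :&: a0 @: B| <= n)%N -> (L - n <= #|A w|)%N.
  move=> wD le_n; have [cW _ _ _] := col w (Dadj w wD).
  by have := cardsID (a0 @: B) (W w); rewrite -/(A w) cW; lia.
have cardDB := cardsID B D.
rewrite (setIidPr sBD) in cardDB.
(* Non-big neighbors come first: their lists may lose [#|B|] colors, but only [#|D| - #|B|]
   representatives are needed, so [#|D| <= L] suffices. *)
have [x1 [x1inj x1A]] : exists h : G -> C, {in set0 :|: (D :\: B) &, injective h} /\
    (forall w, w \in set0 :|: (D :\: B) -> h w \in A w).
  apply: (extend_distinct_representatives (g := fun=> c0)).
  - by move=> w; rewrite inE.
  - by move=> w; rewrite inE.
  - move=> w /setDP[wD _]; rewrite cards0 add0n.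
    apply: leq_trans (cardA w #|B| wD _); first by lia.
    exact: leq_trans (subset_leq_card (subsetIr _ _)) (leq_imset_card _ _).
  - by rewrite disjoints_subset sub0set.
rewrite set0U in x1inj x1A.
(* For big [w], [a0 w] lies outside [W w], so the list loses at most [#|B| - 1] colors; the
   remaining [L + 1 - #|B|] are at least [#|D|]. *)
have [||x [xinj xA]] := extend_distinct_representatives (D1 := B) x1inj x1A.
- move=> w wB; have wD := subsetP sBD w wB.
  apply: leq_trans (cardA w #|B|.-1 wD _).
    have : (0 < #|B|)%N by rewrite card_gt0; apply/set0Pn; exists w.
    lia.
  have -> : #|B|.-1 = #|B :\ w| by rewrite [#|B|](cardsD1 w) wB.
  apply: leq_trans (leq_imset_card a0 _); apply: subset_leq_card.
  apply/subsetP => c /setIP[cW /imsetP[v vB cE]].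
  rewrite cE imset_f // in_setD1 vB andbT; apply: contraTneq cW => vw.
  by rewrite cE vw; apply: contra (a0P w wD) => ?; rewrite inE; apply/orP; left.
- by rewrite disjoints_subset; apply/subsetP => v; rewrite !inE => /andP[].
have DE : D :\: B :|: B = D.
  by have := setID D B; rewrite (setIidPr sBD) setUC.
rewrite DE in xinj xA.
have xW w : w \in D -> x w \in W w by move/xA; rewrite inE => /andP[].
have [a aP] : exists a : G -> C, forall w, w \in D -> (a w \notin F w) && (a w \notin x @: D).
  apply: (dep_choice_in c0 (P := fun w c => (c \notin F w) && (c \notin x @: D))) => w wD.
  have [wB|wB] := boolP (w \in B).
    exists (a0 w); rewrite a0P //; apply/imsetP => -[v vD a0E].
    by have := xA v vD; rewrite inE -a0E imset_f.
  (* Only [D :\ w] counts here, since [x w] lies in [W w] and is thus already excluded by [F w]. *)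
  have [c cN] : exists c, c \notin F w :|: x @: (D :\ w).
    apply: avoid_set.
    have := (leq_card_setU (F w) (x @: (D :\ w))).1; have := cardF w wD.
    have := leq_imset_card x (D :\ w); have := cardsD1 w D; rewrite wD.
    by move: wB; rewrite inE -/D wD /= -leqNgt cardC; lia.
  move: cN; rewrite in_setU negb_or => /andP[cF cx].
  exists c; rewrite cF; apply: contra cx => /imsetP[v vD cE].
  rewrite cE imset_f // in_setD1 vD andbT; apply: contraNneq cF => vw.
  by rewrite cE vw inE xW.
(* The palette of [u] must contain the at most [L] colors [a w] and avoid the at most [M] colors
   [x w]; size [L] fits in between. *)
have [Wu [aWu xWu cWu]] : exists Wu : {set C},
    [/\ a @: D \subset Wu, Wu \subset ~: (x @: D) & #|Wu| = L].
  apply: intermediate_set.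
    apply/subsetP => c /imsetP[w wD ->]; rewrite inE.
    by case/andP: (aP w wD).
  rewrite (leq_trans (leq_imset_card _ _)) // cardsCs setCK cardC.
  have := leq_imset_card x D; have := degM u uX; rewrite -/D; lia.
exists (fun p q => if p == u then x q else if q == u then a p else f p q).
exists (fun p => if p == u then Wu else W p).
move=> v vX; have [->|vu] := eqVneq v u.
  split => //.
  - move=> w wD; have /subsetP/(_ (x w)) := xWu; rewrite inE => h.
    by apply/negP => /h; rewrite imset_f.
  - move=> w wD; have /setD1P[/negPf-> _] := Dadj w wD.
    by rewrite ?eqxx (subsetP aWu) ?imset_f.
have vXu : v \in X :\ u by rewrite !inE vu.
have [cW finj fW Wf] := col v vXu; rewrite induced_neighborsD1 in finj fW Wf.
have vD : u \in induced_neighbors X v -> v \in D by apply: induced_neighbors_sym.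
have aF w : u \in induced_neighbors X v -> w \in induced_neighbors X v -> w != u ->
    a v != f v w.
  move=> /vD/aP/andP[]; rewrite inE negb_or => /andP[_ aN] _ wN wu.
  by apply: contraNneq aN => ->; rewrite imset_f // in_setD1 wu.
split => //.
- move=> y z yN zN; have [yu|yu] := eqVneq y u; have [zu|zu] := eqVneq z u.
  + by rewrite yu zu.
  + by move/eqP; rewrite (negPf (aF z _ _ _)) // -yu.
  + by move/esym/eqP; rewrite (negPf (aF y _ _ _)) // -zu.
  + by apply: finj; rewrite in_setD1 ?yu ?zu.
- move=> y yN; have [yu|yu] := eqVneq y u; last by apply: fW; rewrite in_setD1 yu.
  have /andP[] : (a v \notin F v) && (a v \notin x @: D) by apply/aP/vD; rewrite -yu.
  by rewrite inE negb_or => /andP[].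
- move=> y yN; have [yu|yu] := eqVneq y u; last by apply: Wf; rewrite in_setD1 yu.
  by apply: xW; apply: vD; rewrite -yu.
Qed.

(** * Degree sums and discharging *)

Lemma handshake (G : sgraph) (X : {set G}) :
  (\sum_(v in X) #|induced_neighbors X v|
     <= 2 * #|[set E in edges G | E \subset X]|)%N.
Proof.
set EX := [set E in edges G | E \subset X].
have -> : (\sum_(v in X) #|induced_neighbors X v| =
    \sum_(p : G * G | (p.1 \in X) && (p.2 \in induced_neighbors X p.1)) 1)%N.
  rewrite -(pair_big_dep (mem X) (fun v w => w \in induced_neighbors X v)
    (fun _ _ => 1%N)) /=.
  by apply: eq_bigr => v _; rewrite sum1_card.
(* Each ordered adjacent pair is sent to its edge; a fiber has at most two elements. *)
rewrite (partition_big (fun p : G * G => [set p.1; p.2]) (mem EX)) /=; last first.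
  move=> [v w] /= /andP[vX]; rewrite mem_induced_neighbors => /andP[vw wX].
  rewrite !inE subUset !sub1set vX wX !andbT.
  by apply/existsP; exists v; apply/existsP; exists w; rewrite vw eqxx.
rewrite mulnC -sum_nat_const; apply: leq_sum => E; rewrite !inE => /andP[].
move=> /existsP[x /existsP[y /andP[_ /eqP->]]] _.
rewrite sum1_card; apply: leq_trans (_ : #|[set (x, y); (y, x)]| <= 2)%N; last first.
  by rewrite cards2; case: (_ != _).
apply: subset_leq_card; apply/subsetP => -[v w]; rewrite unfold_in /=.
move=> /andP[/andP[_]]; rewrite mem_induced_neighbors => /andP[vw _] /eqP e.
have vE : v \in [set x; y] by rewrite -e set21.
have wE : w \in [set x; y] by rewrite -e set22.
have vNw : v != w by apply: contraTneq vw => ->; rewrite adj_irrefl.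
move: vE wE vNw; rewrite !inE !xpair_eqE.
by do 2![case/orP => /eqP->]; rewrite !eqxx ?orbT.
Qed.

Lemma sum_induced_degree_lt (R : realFieldType) (k : nat) (G : sgraph)
    (X : {set G}) :
  mad R G < k%:R -> X != set0 ->
  (\sum_(v in X) #|induced_neighbors X v| < k * #|X|)%N.
Proof.
move=> madk X0; set EX := [set E in edges G | E \subset X].
apply: leq_ltn_trans (handshake X) _.
have sub : is_subgraph X EX.
  apply/and3P; split => //; first by apply/subsetP => E; rewrite inE => /andP[].
  by apply/forall_inP => E; rewrite inE => /andP[].
have le_mad : 2 * #|EX|%:R / #|X|%:R <= mad R G.
  exact: (le_bigmax_cond 0 (fun H : {set G} * {set {set G}} =>
    2 * #|H.2|%:R / #|H.1|%:R : R) (j := (X, EX)) sub).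
have := le_lt_trans le_mad madk.
by rewrite ltr_pdivrMr ?ltr0n ?card_gt0 // -!natrM ltr_nat.
Qed.

(* [D] is a lower bound for the degree of a big neighbor of a vertex of degree
   [d]; with [L + 2 - d] big neighbors such a vertex ends with charge [k]. *)
Definition discharging_condition (R : realFieldType) (k L M : nat) : Prop :=
  forall d : nat, (d < k)%N -> (d <= M)%N -> (L.+2 <= d + d)%N ->
    let D : R := M%:R + 2 - d%:R in
    k%:R <= D /\ (k%:R - d%:R) * D <= (L%:R + 2 - d%:R) * (D - k%:R).

Lemma reducible_vertex (R : realFieldType) (k L : nat) (G : sgraph)
    (X : {set G}) :
  (k <= L.+1)%N -> mad R G < k%:R ->
  discharging_condition R k L (max_degree G) -> X != set0 ->
  exists u, [/\ u \in X, (#|induced_neighbors X u| <= L)%N &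
    (#|big_neighbors (max_degree G) X u| + #|induced_neighbors X u| <= L.+1)%N].
Proof.
move=> kL madk dis X0; set M := max_degree G in dis *.
pose d v := #|induced_neighbors X v|; pose B := big_neighbors M X.
have [/exists_inP[u uX /andP[]]|/exists_inPn irr] :=
  boolP [exists u in X, (d u <= L)%N && (#|B u| + d u <= L.+1)%N].
  by exists u.
exfalso.
have deg_lt := sum_induced_degree_lt madk X0.
have dM v : (d v <= M)%N := leq_induced_neighbors X v.
(* As [k <= L.+1], degree below [k] means degree at most [L], so only the number of big neighbors
   can prevent deletion. *)
have big v : v \in X -> (d v < k)%N -> (L.+2 <= #|B v| + d v)%N.
  move=> vX dk; have := irr v vX; rewrite negb_and -!ltnNge -/(d v) -/(B v).
  by case/orP => //; lia.
have sBN v : B v \subset induced_neighbors X v.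
  by apply/subsetP => w; rewrite inE => /andP[].
have cond v : v \in X -> (d v < k)%N -> let D : R := M%:R + 2 - (d v)%:R in
    k%:R <= D /\ (k%:R - (d v)%:R) * D <= (L%:R + 2 - (d v)%:R) * (D - k%:R).
  move=> vX dk; apply: dis => //; apply: leq_trans (big v vX dk) _.
  by rewrite leq_add2r subset_leq_card.
have bigD u v : v \in B u -> M%:R + 2 - (d u)%:R <= (d v)%:R :> R.
  rewrite inE => /andP[_ h]; rewrite lerBlDr -!natrD ler_nat addn2.
  exact: h.
pose low v := (v \in X) && (d v < k)%N.
pose g v : R := 1 - k%:R / (d v)%:R.
have recv u : low u -> k%:R - (d u)%:R <= \sum_(v in B u) g v.
  move=> /andP[uX dk]; have [kD] := cond u uX dk; have bigu := big u uX dk.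
  set D : R := M%:R + 2 - (d u)%:R in kD *.
  have k0 : 0 < k%:R :> R by rewrite ltr0n; case: (k) dk.
  have D0 : 0 < D := lt_le_trans k0 kD.
  (* Divided by [D], the condition reads [k - d <= (L + 2 - d) * (1 - k / D)], and each big neighbor
     gives at least [1 - k / D]. *)
  rewrite -ler_pdivlMr // => /le_trans; apply.
  rewrite -mulrA [(D - _) / D]mulrBl divff ?gt_eqF //.
  apply: le_trans (_ : \sum_(v in B u) (1 - k%:R / D) <= _).
    rewrite sumr_const -[leRHS]mulr_natl ler_wpM2r ?subr_ge0 ?ler_pdivrMr ?mul1r //.
    rewrite lerBlDr -!natrD ler_nat addn2; exact: bigu.
  apply: ler_sum => v vB; have Dv := bigD u v vB.
  rewrite lerB // ler_pM2l // lef_pV2 // posrE //.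
  exact: lt_le_trans D0 Dv.
have give v : v \in X -> ~~ low v ->
    \sum_(u | low u && (v \in B u)) g v <= (d v)%:R - k%:R.
  move=> vX; rewrite /low vX /= -leqNgt => kd.
  (* In degree 0 the quotient in [g v] takes its default value and cannot be cancelled, but then
     nobody receives from [v]. *)
  have [dv0|dv0] := posnP (d v).
    rewrite big1; first by rewrite subr_ge0 ler_nat.
    move=> u /andP[/andP[uX _] /(subsetP (sBN u)) vN].
    have := induced_neighbors_sym uX vN.
    by rewrite (cards0_eq dv0) inE.
  have dvR : 0 < (d v)%:R :> R by rewrite ltr0n.
  have g0 : 0 <= g v by rewrite subr_ge0 ler_pdivrMr // mul1r ler_nat.
  rewrite sumr_const -[leLHS]mulr_natl.
  have -> : (d v)%:R - k%:R = (d v)%:R * g v.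
    by rewrite mulrBr mulr1 mulrCA divff ?mulr1 ?gt_eqF.
  rewrite ler_wpM2r // ler_nat; apply: subset_leq_card; apply/subsetP => u.
  rewrite unfold_in => /andP[/andP[uX _] /(subsetP (sBN u))].
  exact: induced_neighbors_sym.
(* Givers never receive: a big neighbor of a low vertex has degree at least [D >= k]. *)
have high u v : low u -> v \in B u -> (v \in X) && ~~ low v.
  move=> /andP[uX dk] vB.
  have /setIP[_ vX] := subsetP (sBN u) v vB.
  rewrite /low vX /= -leqNgt -(ler_nat R).
  have [kD _] := cond u uX dk; exact: le_trans kD (bigD u v vB).
have : \sum_(u | low u) (k%:R - (d u)%:R) <=
       \sum_(v | (v \in X) && ~~ low v) ((d v)%:R - k%:R : R).
  apply: le_trans (ler_sum _ recv) _.
  rewrite (exchange_big_dep (fun v => (v \in X) && ~~ low v)) //=.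
  by apply: ler_sum => v /andP[]; exact: give.
move: deg_lt; rewrite ltnNge => /negP + h; apply.
rewrite mulnC -sum_nat_const -(ler_nat R) !natr_sum -subr_ge0 -sumrB.
rewrite (bigID low) /= addrC.
have -> : \sum_(i in X | low i) ((d i)%:R - k%:R : R) = - \sum_(u | low u) (k%:R - (d u)%:R).
  rewrite -sumrN; apply: eq_big => [v|v _]; last by rewrite opprB.
  by rewrite /low andbA andbb.
by rewrite subr_ge0.
Qed.

(** * From deletable vertices to incidence colorings *)

Lemma palette_coloring_exists (R : realFieldType) (k L : nat) (G : sgraph)
    (C : finType) (c0 : C) (X : {set G}) :
  #|C| = (max_degree G + L)%N -> (k <= L.+1)%N -> mad R G < k%:R ->
  discharging_condition R k L (max_degree G) ->
  exists (f : G -> G -> C) (W : G -> {set C}), palette_coloring L X f W.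
Proof.
move=> cardC kL madk dis.
have [n] := ubnP #|X|; elim: n X => // n IH X ltXn.
have [->|X0] := eqVneq X set0.
  by exists (fun _ _ => c0), (fun=> set0) => v; rewrite inE.
have [u [uX uL uB]] := reducible_vertex kL madk dis X0.
have [|f [W col]] := IH (X :\ u); first by move: ltXn; rewrite (cardsD1 u) uX.
exact: (extend_palette_coloring c0 cardC
  (fun v _ => leq_induced_neighbors X v) uX uL uB col).
Qed.

Lemma incidenceP (G : sgraph) (i : G * {set G}) :
  is_incidence i -> exists2 w, adj i.1 w & i.2 = [set i.1; w].
Proof.
case: i => v e /andP[/=]; rewrite inE => /existsP[x /existsP[y /andP[xy /eqP->]]].
by case/set2P=> ->; [exists y | exists x; rewrite 1?adj_sym 1?setUC].
Qed.

(** Adjacent incidences either share their vertex, where [f v] is injective, or one is [(v, vx)] and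
    the other a weak incidence of [v], whose colors are separated by [W v]. *)
Lemma colorable_of_palette (R : realFieldType) (L : nat) (G : sgraph)
    (k l : R) f W :
  @palette_coloring G 'I_(max_degree G + L) L setT f W ->
  (max_degree G)%:R + L%:R <= k -> L%:R <= l -> incidence_colorable G k l.
Proof.
move=> col leK leL.
have nT v w : (w \in induced_neighbors setT v) = adj v w.
  by rewrite mem_induced_neighbors inE andbT.
have finj v x y : adj v x -> adj v y -> f v x = f v y -> x = y.
  by have [_ h _ _] := col v (in_setT v); rewrite -!nT; exact: h.
have fW v x y : adj v x -> adj v y -> f v x != f y v.
  rewrite -!nT => vx vy; have [_ _ h h'] := col v (in_setT v).
  by apply: contraTneq (h' _ vy) => <-; apply: h.
(* The successor moves the colors from [0..M+L-1] to [1..M+L]; the default 1 is never taken on an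
   incidence. *)
pose c (i : G * {set G}) : nat :=
  if [pick w | i.2 == [set i.1; w]] is Some w then (f i.1 w).+1 else 1%N.
have cE v w : c (v, [set v; w]) = (f v w).+1.
  rewrite /c /=; case: pickP => [w' /eqP/set2_inj <- //|/(_ w)].
  by rewrite eqxx.
exists c; split.
- move=> [v e] [v' e'] /incidenceP[w /= vw ->] /incidenceP[w' /= vw' ->] ij.
  rewrite !cE eqSS => /or4P[] /=.
  + move/eqP=> vv'; subst v'; apply: contraNneq ij => /val_inj/finj -> //.
  + move=> /eqP e1; have /set2P[vE|vE] : v' \in [set v; w] by rewrite e1 set21.
      by subst v'; move: ij; rewrite e1 eqxx.
    subst v'; move: e1; rewrite setUC => /set2_inj <-.
    by rewrite (inj_eq val_inj) fW.
  + by move/eqP/set2_inj => ?; subst v'; rewrite eq_sym (inj_eq val_inj) fW // adj_sym.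
  + rewrite setUC => /eqP/set2_inj ?; subst w'.
    by rewrite (inj_eq val_inj) fW // adj_sym.
- move=> [v e] /incidenceP[w /= vw ->]; rewrite cE; split => //.
  by apply: le_trans leK; rewrite -natrD ler_nat.
- move=> u; apply: le_trans leL; rewrite ler_nat.
  have [cW _ _ Wf] := col u (in_setT u); rewrite -cW.
  rewrite cardE -(size_map (fun x : 'I_ _ => (val x).+1)).
  apply: uniq_leq_size; first exact: undup_uniq.
  move=> n; rewrite mem_undup => /imageP[i /imsetP[v]]; rewrite inE => uv -> ->.
  by rewrite cE; apply: map_f; rewrite mem_enum Wf // nT.
Qed.

Lemma colorable_of_discharging (R : realFieldType) (k L : nat) (G : sgraph)
    (K l : R) :
  (k <= L.+1)%N -> mad R G < k%:R ->
  discharging_condition R k L (max_degree G) ->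
  (max_degree G)%:R + L%:R <= K -> L%:R <= l -> incidence_colorable G K l.
Proof.
move=> kL madk dis leK leL.
(* With no edges the color type may be empty, so this case is settled directly: there are no
   incidences. *)
have [M0|M0] := posnP (max_degree G).
  have nadj (v w : G) : adj v w = false.
    apply/negP => vw; suff : (0 < max_degree G)%N by rewrite M0.
    by apply: leq_trans (leq_bigmax v); apply/card_gt0P; exists w; rewrite inE.
  have ninc i : ~~ @is_incidence G i.
    by apply/negP => /incidenceP[w]; rewrite nadj.
  exists (fun=> 1%N); split.
  - by move=> i j iI; move: (ninc i); rewrite iI.
  - by move=> i iI; move: (ninc i); rewrite iI.
  - move=> u; apply: le_trans leL; rewrite ler_nat /nb_weak_colors.
    rewrite (_ : weak_incidences u = set0) ?enum_set0 //; last first.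
      by apply/setP => i; rewrite [RHS]inE; apply/imsetP => -[v]; rewrite inE nadj.
    by rewrite /image_mem enum_set0.
have c0 : 'I_(max_degree G + L) by exists 0%N; rewrite addn_gt0 M0.
have [||||f [W col]] := @palette_coloring_exists R k L G _ c0 [set: G] => //.
  by rewrite card_ord.
exact: colorable_of_palette col leK leL.
Qed.

(** * Arithmetic of the two degree bounds *)

Lemma discharging_condition_part1 (R : realFieldType) (k M : nat) :
  (0 < k)%N -> k%:R ^+ 2 / 2 + 3 * k%:R / 2 - 2 <= M%:R :> R ->
  discharging_condition R k k.-1 M.
Proof.
case: k => // k _ hM d dk _ hd D; rewrite -pred_Sn.
have hd' : k.+1%:R + 1 <= 2 * d%:R :> R.
  by rewrite natr1 -natrM ler_nat; lia.
have hdk : d%:R + 1 <= (k.+1)%:R :> R by rewrite natr1 ler_nat; lia.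
have -> : k%:R = k.+1%:R - 1 :> R by rewrite -natr1 addrK.
move: hd' hdk hM; rewrite /D; move: (k.+1%:R) (d%:R) (M%:R) => K x m *.
have K1 : 0 <= K by lra.
(* For [L = k - 1] the second inequality simplifies to [k * (k - d + 1) <= D]. The resulting lower
   bound on [M] is nonincreasing in [d], and the hypothesis is its value at [d = k / 2]. *)
have key : K * (K - x + 1) <= m + 2 - x by nra.
by split; nra.
Qed.

Lemma discharging_condition_part2 (R : realFieldType) (k L M : nat) (alpha : R) :
  0 < alpha -> (1 + alpha) * k%:R < L%:R + 2 ->
  (3 * alpha + 1) / (2 * alpha) * k%:R - 2 <= M%:R ->
  discharging_condition R k L M.
Proof.
move=> a0 hL hM d dk _ hd D.
have hd' : L%:R + 2 <= 2 * d%:R :> R by rewrite -natrD -natrM ler_nat; lia.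
have hdk : d%:R + 1 <= k%:R :> R by rewrite natr1 ler_nat; lia.
have {hM} hM : (3 * alpha + 1) * k%:R <= 2 * alpha * (M%:R + 2).
  by move: hM; rewrite lerBlDr mulrAC ler_pdivrMr ?mulr_gt0 // [_ * (2 * _)]mulrC.
have d0 : 0 <= d%:R :> R by [].
move: hd' hdk hM hL d0; rewrite /D.
move: (k%:R) (d%:R) (M%:R) (L%:R) => K x m l hd' hdk hM hL d0.
(* Replacing [L + 2] by the smaller [(1 + alpha) * k] reduces the goal to
   [k - d + alpha * k <= alpha * D]. Here [(1 + alpha) * k < 2 * d < 2 * k] forces [alpha < 1]. *)
have key : K - x + alpha * K <= alpha * (m + 2 - x) by nra.
have kD : K <= m + 2 - x by rewrite -(ler_pM2l a0); lra.
split=> //; move: key kD; move: (m + 2 - x) => E key kD.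
by nra.
Qed.

Theorem theorem4 (R : realType) (k : nat) (G : sgraph)
    (G_nonempty : (0 < #|G|)%N) (G_connected : connected_graph G)
    (mad_lt : mad R G < k%:R) :
  (k%:R ^+ 2 / 2 + 3 * k%:R / 2 - 2 <= (max_degree G)%:R :> R ->
     incidence_colorable G ((max_degree G)%:R + k%:R - 1 : R) (k%:R - 1)) /\
  (forall alpha : R, 0 < alpha ->
     (3 * alpha + 1) / (2 * alpha) * k%:R - 2 <= (max_degree G)%:R ->
     incidence_colorable G ((max_degree G)%:R + (1 + alpha) * k%:R - 1)
                           ((1 + alpha) * k%:R - 1)).
Proof.
have k0 : (0 < k)%N.
  by rewrite -(ltr0n R); apply: le_lt_trans mad_lt; exact: bigmax_ge_id.
have k1 : 1 <= k%:R :> R by rewrite ler1n.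
split=> [hM|alpha a0 hM].
  have kE : k.-1%:R = k%:R - 1 :> R by rewrite -[in RHS](prednK k0) -natr1 addrK.
  apply: (@colorable_of_discharging R k k.-1) => //; rewrite ?prednK ?kE ?addrA //.
  exact: discharging_condition_part1.
(* Palette sizes are integers, so [L] is the integer part of [l]; [l < L + 1] yields the strict
   bound on [(1 + alpha) * k]. *)
set l := (1 + alpha) * k%:R - 1.
have kl : k%:R - 1 <= l by rewrite /l; nra.
have l0 : 0 <= l by apply: le_trans kl; rewrite subr_ge0.
have /andP[Ll lL] := Num.Theory.truncn_itv l0.
apply: (@colorable_of_discharging R k (Num.truncn l)) => //.
- rewrite -ltnS -(ltr_nat R) -natr1; lra.
- apply: discharging_condition_part2 a0 _ hM.
  by move: lL; rewrite /l -natr1; lra.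
- by rewrite /l in Ll *; lra.
Qed.
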